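(* Let $a,b,q$ be non-zero integers with $q\geq 1$ and $(ab,q)=1$, and let $X,Y\geq 1$ be real numbers. Let $M_{1,2}(X,Y;a,b,q)$ denote the number of pairs $(x,y)\in\mathbb{Z}^2$ with $0<x\leq X$, $0<y\leq Y$, $(xy,q)=1$ and $$ax+by^2\equiv 0 \pmod{q}.$$ Then $$ M_{1,2}(X,Y;a,b,q)=\frac{\varphi(q)}{q^2}\, XY + O\left(\frac{X}{q}\,\tau(q)+L(q)\,\sigma_{-1/2}(q)\left(\frac{Y}{\sqrt{q}}\,\tau(q)+\sqrt{q}\,L(q)\right)\right), $$ where the implied constant is absolute.
   Context: Here $\varphi$ is Euler's totient function, $\tau$ is the divisor function, $L(n):=\log(n+1)$ and $\sigma_{\alpha}(n):=\sum_{d\mid n} d^{\alpha}$. *)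

(* Defs.v *)
From mathcomp Require Import all_boot all_order all_algebra.
From mathcomp Require Import finmap.
From mathcomp Require Import all_classical all_reals all_analysis.

Set Implicit Arguments.
Unset Strict Implicit.
Unset Printing Implicit Defensive.

Import Order.TTheory GRing.Theory Num.Theory.

Local Open Scope classical_set_scope.
Local Open Scope ring_scope.

Definition tau (n : nat) : nat := size (divisors n).

Definition sigma (R : realType) (alpha : R) (n : nat) : R :=
  \sum_(d <- divisors n) d%:R `^ alpha.

Definition L (R : realType) (n : nat) : R := ln (n%:R + 1).

Definition solutions12 (R : realType) (X Y : R) (a b : int) (q : nat) :
    set (int * int) :=
  [set p | let: (x, y) := p in
    [/\ 0 < (x%:~R : R) <= X, 0 < (y%:~R : R) <= Y, coprimez (x * y) q
      & (a * x + b * y ^+ 2 = 0 %[mod q])%Z]].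

(* [fset_set] sends infinite sets to [fset0]; this shows that the default
   value is never used in [M12]. *)
Lemma finite_solutions12 (R : realType) (X Y : R) (a b : int) (q : nat) :
  finite_set (solutions12 X Y a b q).
Proof.
pose n (Z : R) := (Num.truncn Z).+1.
apply: (@sub_finite_set _ _ ((fun p : nat * nat => (p.1%:Z, p.2%:Z)) @`
  (`I_(n X) `*` `I_(n Y)))); last first.
  by apply: finite_image; apply: finite_setX.
have bound (Z : R) (z : int) : 0 < (z%:~R : R) <= Z -> (`|z| < n Z)%N /\ `|z|%N%:Z = z.
  case/andP; rewrite ltr0z => z0 zZ; have zE : `|z|%N%:Z = z by rewrite gtz0_abs.
  split=> //; rewrite -(ltr_nat R); apply: le_lt_trans (truncnS_gt Z).
  by rewrite -[_%:R]/(`|z|%N%:~R) zE.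
case=> x y [/bound[xX xE] /bound[yY yE] _ _].
by exists (`|x|%N, `|y|%N) => //=; rewrite xE yE.
Qed.

Definition M12 (R : realType) (X Y : R) (a b : int) (q : nat) : nat :=
  #|` fset_set (solutions12 X Y a b q)|.

(* Main.v *)
(* Modulo [q] the congruence reads [x + c y^2 = 0] with [c] a unit, and then
   [(x, q) = 1] follows from [(y, q) = 1].  Detect the congruence by additive
   characters [h] modulo [q] and the condition [(y, q) = 1] by Moebius inversion
   over [d | q], replacing [y] by [d y].  The frequency [h = 0] gives the main
   term.  For [h <> 0] the sum over [x] is at most [q/h + q/(q-h)], and the sum
   over [y <= Y/d] is a quadratic Weyl sum whose reduced denominator is
   [r = q / gcd(h d^2, q)]; Weyl differencing bounds it by a multiple of
   [Y/(d sqrt r) + sqrt r L(r)].  Since [d <= gcd(h d^2, q) <= d^2 gcd(h, q)],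
   the first part is at most [Y sqrt(gcd(h, q)/q)] and the second one at most
   [sqrt q d^(-1/2) L(q)]; summing over [d] and [h] gives the error term.
   Passing to the reduced denominator for each [d] separately is what keeps the
   divisor function out of the second part.  Only cosines and sines are used,
   the characters being split into real and imaginary parts. *)
Require Import Defs.
From mathcomp Require Import all_boot all_order all_algebra.
From mathcomp Require Import finmap.
From mathcomp Require Import all_classical all_reals all_analysis.
From mathcomp Require Import ring lra zify.

Set Implicit Arguments.
Unset Strict Implicit.
Unset Printing Implicit Defensive.

Import Order.TTheory GRing.Theory Num.Theory.

Local Open Scope ring_scope.

(** * Cosine sums over arithmetic progressions and lower bounds for the sine *)

(** Each product [2 * sin (theta / 2) * cos (phi + j%:R * theta)] is a difference of sines at
    consecutive half-steps, so the sum telescopes. Keeping the sine as a factor avoids dividing by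
    zero. *)
Lemma sum_cos_arith (R : realType) (phi theta : R) (N : nat) :
  2 * sin (theta / 2) * \sum_(j < N) cos (phi + j%:R * theta) =
  sin (phi + N%:R * theta - theta / 2) - sin (phi - theta / 2).
Proof.
elim: N => [|N IH]; first by rewrite big_ord0 mulr0 mul0r addr0 subrr.
rewrite big_ord_recr /= mulrDr IH.
have -> : phi + N.+1%:R * theta - theta / 2 = phi + N%:R * theta + theta / 2.
  by rewrite -natr1; field.
rewrite (sinD (phi + N%:R * theta) (theta / 2)) (sinB (phi + N%:R * theta)).
ring.
Qed.

Lemma norm_sum_cos_arith (R : realType) (phi theta : R) (N : nat) :
  sin (theta / 2) != 0 ->
  `|\sum_(j < N) cos (phi + j%:R * theta)| <= `|sin (theta / 2)|^-1.
Proof.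
move=> s0; have s_gt0 : 0 < `|sin (theta / 2)| by rewrite normr_gt0.
rewrite -[_^-1]mul1r ler_pdivlMr // mulrC.
have := sum_cos_arith phi theta N => /(congr1 Num.norm).
rewrite !normrM (ger0_norm (ler0n _ 2)) => E.
rewrite -(ler_pM2l (ltr0Sn R 1)) mulrA E mulr1.
apply: le_trans (ler_normB _ _) _.
by rewrite (natrD _ 1 1) lerD // sin_max.
Qed.

Lemma norm_sinDnpi (R : realType) (x : R) (k : nat) : `|sin (x + pi *+ k)| = `|sin x|.
Proof. by rewrite (alternatingn (@sinDpi R)) normrM normrX normrN1 expr1n mul1r. Qed.

(** With [y = x / 2], the double angle formula and the mean value theorem give
    [sin x = 2 cos y cos z y] for some [z] in [(0, y)]. As [y <= pi / 4], both cosines have square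
    at least [1/2] because [cos (2 t) >= 0]. *)
Lemma ler_half_sin (R : realType) (x : R) : 0 <= x <= pi / 2 -> x / 2 <= sin x.
Proof.
case/andP=> x0 xpi; have pi_gt0 := pi_gt0 R.
have [->|xn0] := eqVneq x 0; first by rewrite mul0r sin0.
have x_gt0 : 0 < x by rewrite lt_def xn0.
pose y := x / 2; have y_gt0 : 0 < y by rewrite /y; lra.
have cos_sqr (t : R) : 0 <= t <= y -> 2^-1 <= cos t ^+ 2.
  move=> /andP[t0 ty]; have := cos_mulr2n t; set c := cos t.
  have : 0 <= cos (t *+ 2).
    by apply: cos_ge0_pihalf; rewrite (mulr2n t); rewrite /y in ty; apply/andP; split; lra.
  rewrite (mulr2n (c ^+ 2)); lra.
have cos_pos (t : R) : 0 <= t <= y -> 0 <= cos t.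
  by move=> /andP[t0 ty]; apply: cos_ge0_pihalf; rewrite /y in ty; apply/andP; split; lra.
have [z zin E] : exists2 z, z \in `]0, y[ & sin y - sin 0 = cos z * (y - 0).
  apply: MVT => //.
  by apply: derivable_within_continuous => t _; exact: derivable_sin.
move: zin E; rewrite in_itv /= sin0 !subr0 => /andP[z0 zy] E.
have -> : sin x = 2 * (cos y * cos z) * y.
  have -> : x = y *+ 2 by rewrite (mulr2n y) /y; field.
  by rewrite sin_mulr2n E; ring.
have yb : 0 <= y <= y by rewrite lexx ltW.
have zb : 0 <= z <= y by rewrite !ltW.
suff : 2^-1 <= cos y * cos z by move=> ?; apply: ler_peMl; lra.
have -> : 2^-1 = Num.sqrt (2^-1) * Num.sqrt (2^-1) :> R.
  by rewrite -expr2 sqr_sqrtr.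
by apply: ler_pM; rewrite ?sqrtr_ge0 // -(ger0_norm (cos_pos _ _)) // -sqrtr_sqr ler_wsqrtr // cos_sqr.
Qed.

(** On the first half of the interval this is [ler_half_sin] with [pi >= 2]; the second half follows
    by [t -> 1 - t]. The symmetric minorant has the inverse [1 / t + 1 / (1 - t)], whence the shape
    of [csc_weight]. *)
Lemma ler_sin_pi (R : realType) (t : R) : 0 < t < 1 -> t * (1 - t) <= sin (pi * t).
Proof.
move=> /andP[t0 t1]; have pi2 : 2 <= pi :> R := pi_ge2 R.
have H (s : R) : 0 < s <= 2^-1 -> s <= sin (pi * s).
  move=> /andP[s0 sh]; apply: le_trans (@ler_half_sin R (pi * s) _); first nra.
  by apply/andP; split; nra.
case: (lerP t 2^-1) => th.
  by apply: le_trans (H t _); [nra | rewrite t0].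
have := H (1 - t); rewrite subr_gt0 t1 lerBlDr -lerBlDl; move=> /(_ ltac:(lra)).
rewrite mulrBr mulr1 sinB sinpi cospi mul0r sub0r mulN1r opprK.
nra.
Qed.
(* A majorant of [min(N, 1/|sin(pi m/r)|)], from [sin(pi t) >= t (1 - t)]. *)
Definition csc_weight (R : realType) (N r m : nat) : R :=
  if (r %| m)%N then N%:R else r%:R / (m %% r)%:R + r%:R / (r - m %% r)%:R.

Lemma csc_weight_ge0 (R : realType) (N r m : nat) : 0 <= csc_weight R N r m.
Proof. by rewrite /csc_weight; case: ifP => _; rewrite ?addr_ge0 ?divr_ge0. Qed.

Lemma csc_weight_mod (R : realType) (N r m : nat) :
  csc_weight R N r (m %% r) = csc_weight R N r m.
Proof. by rewrite /csc_weight modn_mod /dvdn modn_mod. Qed.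

Lemma le_csc_weight (R : realType) (N N' r m : nat) :
  (N <= N')%N -> csc_weight R N r m <= csc_weight R N' r m.
Proof. by move=> leN; rewrite /csc_weight; case: ifP => // _; rewrite ler_nat. Qed.

(** The phase [phi] is free, so that sine sums are covered after a shift by a quarter turn. *)
Lemma norm_sum_cos_frac (R : realType) (phi : R) (N r m : nat) : (0 < r)%N ->
  `|\sum_(j < N) cos (phi + j%:R * (pi *+ 2 * m%:R / r%:R))| <= csc_weight R N r m.
Proof.
move=> r0; rewrite /csc_weight /dvdn; have [_|j0] := eqVneq.
  apply: le_trans (ler_norm_sum _ _ _) _.
  apply: le_trans (ler_sum _ (fun j _ => cos_max _)) _.
  by rewrite sumr_const card_ord.
have r0R : 0 < r%:R :> R by rewrite ltr0n.
set j := (m %% r)%N in j0 *.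
have jr : (j < r)%N by rewrite ltn_mod.
have j0R : 0 < j%:R :> R by rewrite ltr0n lt0n.
have jrR : j%:R < r%:R :> R by rewrite ltr_nat.
pose t : R := j%:R / r%:R.
have t01 : 0 < t < 1 by rewrite divr_gt0 //= ltr_pdivrMr // mul1r.
have st := ler_sin_pi t01.
have tt : 0 < t * (1 - t) by case/andP: t01 => ? ?; rewrite mulr_gt0 // subr_gt0.
have E : `|sin (pi *+ 2 * m%:R / r%:R / 2)| = `|sin (pi * t)| :> R.
  rewrite -(norm_sinDnpi (pi * t) (m %/ r)); congr `|sin _|.
  rewrite {1}(divn_eq m r) -/j natrD natrM -(mulr_natr pi (m %/ r)) -(mulr_natr pi 2) /t.
  by field; rewrite gt_eqF.
have leE : t * (1 - t) <= `|sin (pi *+ 2 * m%:R / r%:R / 2)| :> R.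
  by rewrite E (le_trans st) // ler_norm.
have s_gt0 := lt_le_trans tt leE.
apply: le_trans (norm_sum_cos_arith _ _ _) _; first by rewrite -normr_gt0.
apply: le_trans (_ : (t * (1 - t))^-1 <= _); first by rewrite lef_pV2.
rewrite (natrB _ (ltnW jr)) /t.
rewrite [leLHS](_ : _ = r%:R / j%:R + r%:R / (r%:R - j%:R)) //.
by field; rewrite !gt_eqF // subr_gt0.
Qed.

Lemma sum_cos_dvd (R : realType) (q n : nat) : (0 < q)%N ->
  \sum_(h < q) cos (pi *+ 2 * h%:R * n%:R / q%:R) = (q * (q %| n))%:R :> R.
Proof.
move=> q0; have q0R : q%:R != 0 :> R by rewrite pnatr_eq0 -lt0n.
have [/dvdnP[k ->]|nd] := boolP (q %| n)%N.
  rewrite muln1 (eq_bigr (fun=> 1)) ?sumr_const ?card_ord // => h _.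
  have -> : pi *+ 2 * h%:R * (k * q)%:R / q%:R = 0 + pi *+ 2 *+ (h * k) :> R.
    by rewrite -[_ *+ (h * k)]mulr_natr !natrM; field.
  by rewrite (periodicn (@cosD2pi R)) cos0.
pose theta : R := pi *+ 2 * n%:R / q%:R.
have s0 : sin (theta / 2) != 0.
  pose j := (n %% q)%N; pose t : R := j%:R / q%:R.
  have j0 : (0 < j)%N by rewrite lt0n.
  have t01 : 0 < t < 1.
    by rewrite divr_gt0 ?ltr0n //= ltr_pdivrMr ?ltr0n // mul1r ltr_nat ltn_mod.
  rewrite -normr_gt0.
  have -> : theta / 2 = pi * t + pi *+ (n %/ q).
    rewrite /theta {1}(divn_eq n q) -/j natrD natrM.
    by rewrite -(mulr_natr pi (n %/ q)) -(mulr_natr pi 2) /t; field.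
  rewrite norm_sinDnpi normr_gt0 gt_eqF //; apply: lt_le_trans (ler_sin_pi t01).
  by case/andP: t01 => ? ?; rewrite mulr_gt0 // subr_gt0.
rewrite muln0 (eq_bigr (fun h : 'I_q => cos (0 + h%:R * theta))); last first.
  by move=> h _; congr cos; rewrite /theta; ring.
have /eqP := sum_cos_arith 0 theta q.
(* After [q] steps the angle has made [n] full turns, so the two endpoint sines of the telescoped
   sum cancel. *)
have -> : 0 + q%:R * theta - theta / 2 = - (theta / 2) + pi *+ 2 *+ n.
  by rewrite -[_ *+ n]mulr_natr /theta; field.
rewrite (periodicn (@sinD2pi R)) sub0r subrr !mulf_eq0 (negPf s0) orbF.
by rewrite pnatr_eq0 /= => /eqP.
Qed.

(** * Harmonic sums, and the total of the weights over a period *)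

(** From [ln (1 - 1 / (j + 1)) <= - 1 / (j + 1)] the logarithmic increment is at least
    [1 / (j + 1)]; the factor 2 pays for replacing [j + 1] by [j]. *)
Lemma ler_inv_ln (R : realType) (j : nat) : (0 < j)%N ->
  j%:R^-1 <= 2 * (ln j.+1%:R - ln j%:R) :> R.
Proof.
move=> j0; have j0R : 0 < j%:R :> R by rewrite ltr0n.
have j1 : 1 <= j%:R :> R by rewrite ler1n.
have jS : 0 < j.+1%:R :> R by rewrite ltr0n.
have : ln (1 + - (j.+1%:R)^-1) <= - (j.+1%:R)^-1 :> R.
  by apply: le_ln1Dx; rewrite ltrN2 invf_lt1 // ltr1n.
have -> : 1 + - (j.+1%:R)^-1 = j%:R / j.+1%:R :> R.
  by rewrite -natr1; field; rewrite natr1 gt_eqF.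
rewrite ln_div ?posrE // => H.
rewrite lerNr opprB in H.
apply: le_trans (_ : 2 * j.+1%:R^-1 <= _); last by rewrite ler_pM2l.
rewrite ler_pdivlMr // mulrC ler_pdivrMr // -natr1; lra.
Qed.

Lemma harmonic_le_ln (R : realType) (n : nat) :
  \sum_(1 <= j < n.+1) j%:R^-1 <= 2 * ln n.+1%:R :> R.
Proof.
elim: n => [|n IH]; first by rewrite big_geq // ln1 mulr0.
rewrite big_nat_recr //=; apply: le_trans (lerD IH (ler_inv_ln R (ltn0Sn n))) _.
by rewrite mulrBr addrC subrK.
Qed.

Lemma harmonic_le_L (R : realType) (r : nat) :
  \sum_(1 <= j < r) j%:R^-1 <= 2 * L R r.
Proof.
rewrite /L natr1; apply: le_trans (harmonic_le_ln R r).
case: r => [|r]; first by rewrite !big_geq.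
by rewrite [leRHS]big_nat_recr //= lerDl.
Qed.

Lemma le_L (R : realType) (m n : nat) : (m <= n)%N -> L R m <= L R n.
Proof. by move=> mn; rewrite /L ler_ln ?posrE ?natr1 ?ltr0n // ler_nat. Qed.

(** Lets constants be absorbed into logarithms later on. *)
Lemma half_le_L (R : realType) (n : nat) : (0 < n)%N -> 2^-1 <= L R n.
Proof.
move=> n0; apply: le_trans (le_L R n0).
by have := harmonic_le_ln R 1; rewrite big_nat1 invr1 /L natr1; lra.
Qed.

(** The residue 0 contributes [N]. The reflection [m -> r - m] identifies the two remaining sums,
    each at most [r] times a harmonic sum. *)
Lemma sum_csc_weight (R : realType) (N r : nat) : (0 < r)%N ->
  \sum_(m < r) csc_weight R N r m <= N%:R + 4 * r%:R * L R r.
Proof.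
move=> r0; rewrite -(big_mkord xpredT (csc_weight R N r)) big_ltn // lerD //.
  by rewrite /csc_weight dvdn0.
rewrite (eq_big_nat _ _ (F2 := fun j => r%:R * (j%:R^-1 + (r - j)%:R^-1))); last first.
  move=> j /andP[j0 jr]; rewrite /csc_weight /dvdn modn_small //.
  by rewrite -[j == 0%N]negbK -lt0n j0 /= mulrDr.
rewrite -mulr_sumr big_split /=.
rewrite [X in _ * (_ + X)]big_nat_rev /=.
rewrite [X in _ * (_ + X)](eq_big_nat _ _ (F2 := fun j => j%:R^-1)); last first.
  by move=> j /andP[j0 jr]; congr (_%:R^-1); lia.
have := harmonic_le_L R r; have : 0 < r%:R :> R by rewrite ltr0n.
nra.
Qed.

(** * Weyl differencing for quadratic sums *)

(** The pairs [i > j] are grouped by their difference [l + 1]; passing from [N] to [N + 1] adds one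
    new pair to each diagonal and opens one new diagonal, which together form the row [i = N]. *)
Lemma sum_diag_recr (V : nmodType) (F : nat -> nat -> V) (N : nat) :
  \sum_(l < N.+1) \sum_(j < N.+1 - l.+1) F (j + l.+1)%N j =
  \sum_(l < N) \sum_(j < N - l.+1) F (j + l.+1)%N j + \sum_(j < N) F N j.
Proof.
rewrite big_ord_recr /= subnn big_ord0 addr0 [X in _ = _ + X](reindex_inj rev_ord_inj) /=.
rewrite -big_split /=; apply: eq_bigr => l _.
rewrite (_ : N.+1 - l.+1 = (N - l.+1).+1)%N; last by have := ltn_ord l; lia.
by rewrite big_ord_recr /= (subnK (ltn_ord l)).
Qed.

(** This is the squared modulus of the sum of [exp (i a)], expanded in real form: the diagonal gives
    [N], and each unordered pair occurs twice. *)
Lemma sqr_sum_cos_sin (R : realType) (a : nat -> R) (N : nat) :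
  (\sum_(i < N) cos (a i)) ^+ 2 + (\sum_(i < N) sin (a i)) ^+ 2 =
  N%:R + 2 * \sum_(l < N) \sum_(j < N - l.+1) cos (a (j + l.+1)%N - a j).
Proof.
elim: N => [|N IH]; first by rewrite !big_ord0 expr0n mulr0 !addr0.
rewrite (sum_diag_recr (fun i j => cos (a i - a j))) mulrDr addrA -natr1.
rewrite (addrAC N%:R 1) -IH !big_ord_recr /=.
have -> : \sum_(j < N) cos (a N - a j) =
    cos (a N) * \sum_(j < N) cos (a j) + sin (a N) * \sum_(j < N) sin (a j).
  by rewrite !mulr_sumr -big_split; apply: eq_bigr => j _; rewrite cosB.
have := cos2Dsin2 (a N); lra.
Qed.

Lemma sum_periodic_le (R : realType) (g : nat -> R) (r N : nat) :
  (0 < r)%N -> (forall m, 0 <= g m) -> (forall m, g (m %% r)%N = g m) ->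
  \sum_(l < N) g l <= (N%:R / r%:R + 1) * \sum_(l < r) g l.
Proof.
move=> r0 g0 gr.
have blocks k : \sum_(l < k * r) g l = k%:R * \sum_(l < r) g l.
  elim: k => [|k IH]; first by rewrite mul0n big_ord0 mul0r.
  rewrite mulSn addnC big_split_ord /= IH -natr1 mulrDl mul1r; congr (_ + _).
  by apply: eq_bigr => l _; rewrite -gr modnMDl gr.
apply: le_trans (_ : \sum_(l < (N %/ r).+1 * r) g l <= _).
  have le : (N <= (N %/ r).+1 * r)%N by rewrite ltnW // ltn_ceil.
  by rewrite (big_ord_widen _ g le) [leRHS](bigID (fun l : 'I__ => (l < N)%N)) /= lerDl sumr_ge0.
rewrite blocks ler_wpM2r ?sumr_ge0 // -natr1 lerD2r ler_pdivlMr ?ltr0n //.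
by rewrite -natrM ler_nat leq_trunc_div.
Qed.

(** Multiplication by the unit [alpha] permutes the residues, which leaves the weights at the even
    numbers below [2 r]. These are among two full periods, whatever the parity of [r]. *)
Lemma sum_csc_weight_double (R : realType) (N r alpha : nat) :
  (0 < r)%N -> coprime alpha r ->
  \sum_(l < r) csc_weight R N r (2 * alpha * l.+1) <= 2 * \sum_(m < r) csc_weight R N r m.
Proof.
move=> r0 co; case: r r0 co => // r _ co.
pose f (l : 'I_r.+1) : 'I_r.+1 := inord (alpha * l.+1 %% r.+1).
have f_val l : f l = (alpha * l.+1 %% r.+1)%N :> nat by rewrite inordK // ltn_mod.
have f_inj : injective f.
  move=> l l' /(congr1 val) /=; rewrite !f_val => /eqP.
  wlog le : l l' / (l <= l')%N.
    by move=> H; case/orP: (leq_total l l') => le E; [|symmetry]; apply: H; rewrite // eq_sym.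
  rewrite eq_sym eqn_mod_dvd ?leq_mul2l ?ltnS ?le ?orbT // -mulnBr subSS.
  rewrite Gauss_dvdr 1?coprime_sym // /dvdn modn_small; last by have := ltn_ord l'; lia.
  by move=> /eqP E; apply/val_inj => /=; lia.
pose g m := csc_weight R N r.+1 m.
rewrite (eq_bigr (fun l => g (2 * f l)%N)); last first.
  by move=> l _; rewrite /g -csc_weight_mod -[RHS]csc_weight_mod f_val modnMmr mulnA.
have -> : \sum_(l < r.+1) g (2 * f l)%N = \sum_(l < r.+1) g (2 * l)%N.
  by rewrite [RHS](reindex_inj f_inj).
have pairs k : \sum_(m < 2 * k) g m = \sum_(m < k) (g (2 * m)%N + g (2 * m).+1).
  elim: k => [|k IH]; first by rewrite muln0 !big_ord0.
  rewrite (_ : 2 * k.+1 = (2 * k).+2)%N; last by rewrite mulnS.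
  by rewrite !big_ord_recr /= IH addrA.
apply: le_trans (_ : \sum_(m < 2 * r.+1) g m <= _).
  by rewrite pairs; apply: ler_sum => m _; rewrite lerDl csc_weight_ge0.
rewrite mul2n -addnn big_split_ord /= (natrD _ 1 1) mulrDl mul1r lerD2l le_eqVlt.
apply/orP; left; apply/eqP/eq_bigr => m _.
by rewrite /g -csc_weight_mod modnDl csc_weight_mod.
Qed.

(* Weyl differencing: the square of the sum is a sum over shifts [l] of sums of
   an arithmetic progression of angles with step [2 alpha (l + 1) / r]. *)
Lemma weyl_sqr (R : realType) (alpha r N : nat) (a : nat -> R) :
  (0 < r)%N -> coprime alpha r ->
  (forall i, a i = pi *+ 2 * (alpha * i.+1 ^ 2)%:R / r%:R) ->
  (\sum_(i < N) cos (a i)) ^+ 2 + (\sum_(i < N) sin (a i)) ^+ 2 <=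
  (6 * (N%:R / Num.sqrt r%:R + Num.sqrt r%:R * L R r)) ^+ 2.
Proof.
move=> r0 co aE; rewrite sqr_sum_cos_sin.
set S := \sum_(l < N) _.
have leS : S <= (N%:R / r%:R + 1) * (2 * (N%:R + 4 * r%:R * L R r)).
  pose g l := csc_weight R N r (2 * alpha * l.+1).
  apply: le_trans (_ : \sum_(l < N) g l <= _).
    apply: ler_sum => l _; apply: le_trans (ler_norm _) _.
    apply: le_trans (le_csc_weight R r (2 * alpha * l.+1) (leq_subr l.+1 N)).
    pose phi : R := pi *+ 2 * (alpha * (2 * l.+1 + l.+1 ^ 2))%:R / r%:R.
    rewrite (eq_bigr (fun j : 'I__ =>
      cos (phi + j%:R * (pi *+ 2 * (2 * alpha * l.+1)%:R / r%:R)))).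
      exact: norm_sum_cos_frac.
    move=> j _; congr cos; rewrite !aE.
    (* The difference of two squares at fixed distance [l + 1] is linear in [j], so the angles form
       an arithmetic progression. *)
    have -> : (alpha * (j + l.+1).+1 ^ 2 = alpha * j.+1 ^ 2 +
      (alpha * (2 * l.+1 + l.+1 ^ 2) + j * (2 * alpha * l.+1)))%N by ring.
    by rewrite !natrD (natrM _ j) /phi; ring.
  have g0 m : 0 <= g m by exact: csc_weight_ge0.
  have gr m : g (m %% r)%N = g m.
    rewrite /g -csc_weight_mod -[RHS]csc_weight_mod; congr csc_weight.
    have E : (m %% r).+1 = m.+1 %[mod r] by rewrite -addn1 modnDml addn1.
    by rewrite -modnMmr E modnMmr.
  apply: le_trans (sum_periodic_le N r0 g0 gr) _.
  rewrite ler_wpM2l ?addr_ge0 ?divr_ge0 //.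
  apply: le_trans (sum_csc_weight_double R N r0 co) _.
  by rewrite ler_wpM2l // sum_csc_weight.
have r0R : 0 < r%:R :> R by rewrite ltr0n.
have s0 : 0 < Num.sqrt r%:R :> R by rewrite sqrtr_gt0.
have L2 := half_le_L R r0.
have N0 : 0 <= N%:R :> R by [].
move: leS; rewrite -{1 2}(sqr_sqrtr (ltW r0R)).
set s := Num.sqrt _ in s0 *; set n := N%:R in N0 *; set la := L R r in L2 *.
(* In terms of [u] and [s] the bound is polynomial. Since [1 <= 2 * la], the terms [u * s] and
   [s ^+ 2 * la] are absorbed into [u * s * la] and [s ^+ 2 * la ^+ 2], and all coefficients stay
   below those of [36 (u + s la)^2]. *)
move=> leS; pose u := n / s.
have nE : n = u * s by rewrite /u; field; rewrite gt_eqF.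
have u0 : 0 <= u by rewrite divr_ge0 // ltW.
have E : n / s ^+ 2 = u / s by rewrite /u; field; rewrite gt_eqF.
have E1 : (u / s + 1) * (2 * (u * s + 4 * s ^+ 2 * la)) = 2 * (u ^+ 2 + 4 * (u * s * la) + u * s + 4 * s ^+ 2 * la).
  by field; rewrite gt_eqF.
rewrite -/u nE; rewrite E nE E1 in leS.
apply: le_trans (lerD (lexx _) (ler_wpM2l _ leS)) _ => //.
have us0 : 0 <= u * s by rewrite mulr_ge0 // ltW.
have ss0 : 0 <= s ^+ 2 by exact: sqr_ge0.
have usl : u * s <= 2 * (u * s * la) by nra.
have ssl : s ^+ 2 * la <= 2 * (s ^+ 2 * la ^+ 2) by nra.
nra.
Qed.
(** The fraction [m / q] is put in lowest terms [alpha / r] before [weyl_sqr] is applied; each of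
    the two sums is then bounded through the sum of their squares. *)
Lemma quadratic_sum_le (R : realType) (q m N : nat) (a : nat -> R) : (0 < q)%N ->
  (forall i, a i = pi *+ 2 * (m * i.+1 ^ 2)%:R / q%:R) ->
  let B := 6 * (N%:R * (Num.sqrt (gcdn m q)%:R / Num.sqrt q%:R)
                + Num.sqrt q%:R / Num.sqrt (gcdn m q)%:R * L R q) in
  `|\sum_(i < N) cos (a i)| <= B /\ `|\sum_(i < N) sin (a i)| <= B.
Proof.
move=> q0 aE B; pose g := gcdn m q; pose r := (q %/ g)%N; pose alpha := (m %/ g)%N.
have g0 : (0 < g)%N by rewrite gcdn_gt0 q0 orbT.
have qE : q = (r * g)%N by rewrite /r divnK // dvdn_gcdr.
have mE : m = (alpha * g)%N by rewrite /alpha divnK // dvdn_gcdl.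
have r0 : (0 < r)%N by rewrite qE muln_gt0 in q0; case/andP: q0.
have co : coprime alpha r.
  rewrite /coprime -(eqn_pmul2r g0) mul1n muln_gcdl -qE -mE; exact: eqxx.
have g0R : 0 < g%:R :> R by rewrite ltr0n.
have r0R : 0 < r%:R :> R by rewrite ltr0n.
have sg0 : 0 < Num.sqrt g%:R :> R by rewrite sqrtr_gt0.
have sr0 : 0 < Num.sqrt r%:R :> R by rewrite sqrtr_gt0.
have sqE : Num.sqrt q%:R = Num.sqrt r%:R * Num.sqrt g%:R :> R.
  by rewrite qE natrM sqrtrM // ltW.
have LB : 6 * (N%:R / Num.sqrt r%:R + Num.sqrt r%:R * L R r) <= B.
  rewrite /B -/g sqE ler_wpM2l // lerD //.
    rewrite ler_wpM2l // le_eqVlt; apply/orP; left; apply/eqP.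
    by field; rewrite !gt_eqF.
  by rewrite mulfK ?gt_eqF // ler_wpM2l ?sqrtr_ge0 // le_L // /r leq_div.
have L0 : 0 <= L R r by apply: le_trans (half_le_L R r0).
have B0 : 0 <= B.
  by apply: le_trans LB; rewrite mulr_ge0 // addr_ge0 ?mulr_ge0 ?invr_ge0 // ltW.
have aE' i : a i = pi *+ 2 * (alpha * i.+1 ^ 2)%:R / r%:R.
  by rewrite aE mE qE !natrM; field; rewrite !gt_eqF.
have sq : (\sum_(i < N) cos (a i)) ^+ 2 + (\sum_(i < N) sin (a i)) ^+ 2 <= B ^+ 2.
  apply: le_trans (weyl_sqr N r0 co aE') _; rewrite ler_sqr ?nnegrE //.
  by rewrite mulr_ge0 // addr_ge0 ?mulr_ge0 ?invr_ge0 // ltW.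
split; rewrite -(ger0_norm B0) -ler_sqr ?nnegrE // !real_normK ?num_real //.
  by apply: le_trans sq; rewrite lerDl sqr_ge0.
by apply: le_trans sq; rewrite lerDr sqr_ge0.
Qed.

(** * Moebius inversion over divisors, and gcd averages *)

Lemma le_sum_subseq (R : numDomainType) (s t : seq nat) (F : nat -> R) :
  uniq s -> {subset s <= t} -> (forall i, 0 <= F i) ->
  \sum_(i <- s) F i <= \sum_(i <- t) F i.
Proof.
elim: s t => [|x s IH] t; first by move=> _ _ F0; rewrite big_nil sumr_ge0.
move=> /= /andP[xs us] st F0; have xt : x \in t by apply: st; rewrite mem_head.
rewrite big_cons (perm_big _ (perm_to_rem xt)) big_cons lerD2l IH // => y ys.
have yx : y != x by apply: contraNneq xs => <-.
have : y \in t by apply: st; rewrite in_cons ys orbT.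
by rewrite (perm_mem (perm_to_rem xt)) in_cons (negPf yx).
Qed.

(* Moebius inversion: [eps] is the Moebius function on the squarefree divisors
   [ds] of [q]; only the bound on [eps] is needed. *)
Lemma coprime_moebius (R : realType) (q : nat) : (0 < q)%N ->
  exists ds : seq nat, exists eps : nat -> R,
    [/\ uniq ds, {subset ds <= divisors q}, forall d, `|eps d| <= 1 &
        forall y, (0 < y)%N ->
          (coprime y q)%:R = \sum_(d <- ds) eps d * (d %| y)%N%:R].
Proof.
move=> q0.
(* Generalized for induction on the list of primes. That every prime factor of [d] lies in the list
   ensures that a newly added prime is coprime to every earlier [d]. *)
suff [ds [eps [uds dsq epsb E]]] : exists ds : seq nat, exists eps : nat -> R,
    [/\ uniq ds,
        forall d, d \in ds -> (d %| q)%N /\ (forall p, prime p -> (p %| d)%N -> p \in primes q),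
        forall d, `|eps d| <= 1 &
        forall y, (all (fun p => ~~ (p %| y)%N) (primes q))%:R =
          \sum_(d <- ds) eps d * (d %| y)%N%:R].
  exists ds, eps; split => // [d /dsq[dq _]|y y0]; first by rewrite -dvdn_divisors.
  rewrite -E coprime_has_primes // -all_predC; congr (_%:R); congr (nat_of_bool _).
  apply/eq_in_all => p pq /=; rewrite mem_primes y0 /=.
  by move: pq; rewrite mem_primes => /and3P[-> _ _].
have: all (fun p => prime p && (p %| q)%N) (primes q).
  by apply/allP => p; rewrite mem_primes q0.
elim: (primes q) (primes_uniq q) => [_ _|p ps IH].
  exists [:: 1%N], (fun=> 1); split => // [d|d|y]; last by rewrite big_seq1 /= dvd1n mulr1.
    rewrite inE => /eqP ->; split; first exact: dvd1n.
    by move=> p pp; rewrite dvdn1 => /eqP p1; rewrite p1 in pp.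
  by rewrite normr1.
move=> /= /andP[pps ups] /andP[/andP[pp pq] allps].
have [ds [eps [uds dsq epsb E]]] := IH ups allps.
have p0 := prime_gt0 pp.
have pd d : d \in ds -> ~~ (p %| d)%N.
  by move=> /dsq[_ H]; apply: contra pps => /(H p pp).
(* Adding [p] multiplies the indicator by [1 - [p | y]]: each old [d] stays, and [p * d] joins with
   the opposite sign. *)
exists (ds ++ map (muln p) ds).
exists (fun d => if (p %| d)%N then - eps (d %/ p)%N else eps d).
split.
- rewrite cat_uniq uds map_inj_uniq ?uds ?andbT /=; last first.
    by move=> x y /eqP; rewrite eqn_pmul2l // => /eqP.
  by apply/hasPn => _ /mapP[d _ ->] /=; apply: contraL (dvdn_mulr d (dvdnn p)); exact: pd.
- move=> d; rewrite mem_cat => /orP[/dsq[dq H]|/mapP[e eds ->]].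
    by split=> // p' pp' /(H p' pp') H'; rewrite in_cons H' orbT.
  have [eq H] := dsq e eds.
  split; first by rewrite Gauss_dvd ?pq // prime_coprime // pd.
  move=> p' pp'; rewrite Euclid_dvdM // => /orP[|/(H p' pp') H'].
    by rewrite dvdn_prime2 // => /eqP ->; rewrite mem_head.
  by rewrite in_cons H' orbT.
- by move=> d; case: ifP => _; rewrite ?normrN.
move=> y; rewrite big_cat big_map /=.
rewrite [X in X + _](_ : _ = \sum_(d <- ds) eps d * (d %| y)%N%:R); last first.
  by apply: eq_big_seq => d dds; rewrite (negPf (pd d dds)).
rewrite [X in _ + X](_ : _ = \sum_(d <- ds) - (p %| y)%N%:R * (eps d * (d %| y)%N%:R)); last first.
  apply: eq_big_seq => d dds; rewrite dvdn_mulr // mulKn //.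
  rewrite Gauss_dvd ?prime_coprime ?pd //.
  by case: (p %| y)%N; case: (d %| y)%N; rewrite /=; ring.
rewrite -mulr_sumr -E; case: (p %| y)%N; case: (all _ _); rewrite /=; ring.
Qed.

Lemma sum_multiples (V : pzSemiRingType) (d N : nat) (F : nat -> V) : (0 < d)%N ->
  \sum_(j < N) (d %| j.+1)%N%:R * F j.+1 = \sum_(k < N %/ d) F (d * k.+1)%N.
Proof.
move=> d0; elim: N => [|N IH]; first by rewrite div0n !big_ord0.
rewrite big_ord_recr /= IH divnS //.
have [dN|] := boolP (d %| N.+1)%N; last by rewrite mul0r addr0.
rewrite add1n big_ord_recr /= mul1r; congr (_ + F _).
by rewrite -[LHS](divnK dN) divnS // dN add1n mulnC.
Qed.

Lemma powR_invsqrt (R : realType) (d : nat) : (0 < d)%N ->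
  d%:R `^ (- 2^-1) = (Num.sqrt d%:R)^-1 :> R.
Proof. by move=> d0; rewrite powRN powR12_sqrt // ler0n. Qed.

Lemma sigmaE (R : realType) (q : nat) : (0 < q)%N ->
  sigma (- 2^-1) q = \sum_(d <- divisors q) (Num.sqrt d%:R)^-1 :> R.
Proof.
move=> q0; apply: eq_big_seq => d; rewrite -dvdn_divisors // => dq.
by rewrite powR_invsqrt // (dvdn_gt0 q0 dq).
Qed.

(** The root of the gcd is at most the sum of [sqrt g] over all common divisors [g]. After
    exchanging the sums, the multiples [h = g k] contribute [1 / sqrt g] times a harmonic sum. *)
Lemma sum_sqrt_gcd (R : realType) (q : nat) : (0 < q)%N ->
  \sum_(1 <= h < q) Num.sqrt (gcdn h q)%:R / h%:R <= 2 * L R q * sigma (- 2^-1) q :> R.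
Proof.
move=> q0; rewrite sigmaE // mulr_sumr.
apply: le_trans (_ : \sum_(1 <= h < q) \sum_(g <- divisors q)
    (g %| h)%N%:R * (Num.sqrt g%:R / h%:R) <= _).
  apply: ler_sum_nat => h /andP[h1 hq].
  have gq : gcdn h q \in divisors q by rewrite -dvdn_divisors // dvdn_gcdr.
  rewrite (big_rem _ gq) /= dvdn_gcdl mul1r lerDl sumr_ge0 //.
rewrite exchange_big /= big_seq [leRHS]big_seq ler_sum // => g; rewrite -dvdn_divisors // => gq.
have g0 := dvdn_gt0 q0 gq.
have s0 : 0 < Num.sqrt g%:R :> R by rewrite sqrtr_gt0 ltr0n.
rewrite big_add1 big_mkord.
rewrite (sum_multiples q.-1 (fun h => Num.sqrt g%:R / h%:R) g0).
rewrite (eq_bigr (fun k : 'I__ => (Num.sqrt g%:R)^-1 * (k.+1)%:R^-1)); last first.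
  move=> k _; rewrite natrM -{2}(sqr_sqrtr (ler0n R g)) invfM mulrA expr2 invfM.
  by rewrite mulrA divff ?gt_eqF // mul1r.
rewrite -mulr_sumr mulrC ler_wpM2r ?invr_ge0 ?sqrtr_ge0 //.
apply: le_trans _ (harmonic_le_L R q).
rewrite big_add1 -(big_mkord xpredT (fun k => (k.+1%:R : R)^-1)).
by rewrite [leRHS](big_cat_nat (leq0n _) (leq_div q.-1 g)) /= lerDl sumr_ge0 //.
Qed.

(** * Double sums at one frequency, and the count expressed through them *)

(** The addition formula for the cosine separates the variables into two products of single sums,
    one of cosines and one of sines. Each product costs [W] times the Weyl bound with constant 6,
    which makes 12. *)
Lemma quadratic_double_sum_le (R : realType) (q c d h M N : nat) :
  (0 < h < q)%N -> (d %| q)%N -> coprime c q ->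
  `|\sum_(k < N) \sum_(i < M)
      cos (pi *+ 2 * h%:R * (i.+1 + c * (d * k.+1) ^ 2)%:R / q%:R)| <=
  12 * (q%:R / h%:R + q%:R / (q - h)%:R)
     * ((N * d)%:R * (Num.sqrt (gcdn h q)%:R / Num.sqrt q%:R)
        + Num.sqrt q%:R / Num.sqrt d%:R * L R q) :> R.
Proof.
move=> /andP[h0 hq] dq co; have q0 : (0 < q)%N by apply: leq_trans hq.
have q0R : 0 < q%:R :> R by rewrite ltr0n.
have d0 := dvdn_gt0 q0 dq.
pose A (i : nat) : R := pi *+ 2 * h%:R * i.+1%:R / q%:R.
pose m := (h * c * d ^ 2)%N.
pose B (k : nat) : R := pi *+ 2 * (m * k.+1 ^ 2)%:R / q%:R.
set W := q%:R / h%:R + _.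
have WE : csc_weight R M q h = W.
  by rewrite /csc_weight gtnNdvd // modn_small.
have W0 : 0 <= W by rewrite -WE csc_weight_ge0.
have cosA : `|\sum_(i < M) cos (A i)| <= W.
  rewrite -WE; pose phi : R := pi *+ 2 * h%:R / q%:R.
  rewrite (eq_bigr (fun i : 'I_M => cos (phi + i%:R * (pi *+ 2 * h%:R / q%:R)))).
    exact: norm_sum_cos_frac.
  by move=> i _; congr cos; rewrite /A /phi -natr1; ring.
have sinA : `|\sum_(i < M) sin (A i)| <= W.
  rewrite -WE; pose phi : R := pi *+ 2 * h%:R / q%:R - pi / 2.
  rewrite (eq_bigr (fun i : 'I_M => cos (phi + i%:R * (pi *+ 2 * h%:R / q%:R)))).
    exact: norm_sum_cos_frac.
  by move=> i _; rewrite -cosBpihalf; congr cos; rewrite /A /phi -natr1; ring.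
have [cosB sinB] := quadratic_sum_le N q0 (fun k => erefl (B k)).
rewrite -/m in cosB sinB.
set K := 6 * _ in cosB sinB.
have -> : \sum_(k < N) \sum_(i < M)
      cos (pi *+ 2 * h%:R * (i.+1 + c * (d * k.+1) ^ 2)%:R / q%:R) =
    (\sum_(i < M) cos (A i)) * (\sum_(k < N) cos (B k))
    - (\sum_(i < M) sin (A i)) * (\sum_(k < N) sin (B k)).
  rewrite !mulr_sumr -sumrB; apply: eq_bigr => k _.
  rewrite !mulr_suml -sumrB; apply: eq_bigr => i _.
  rewrite -cosD; congr cos.
  by rewrite /A /B /m natrD !natrM; ring.
apply: le_trans (ler_normB _ _) _; rewrite !normrM.
apply: le_trans (lerD (ler_pM (normr_ge0 _) (normr_ge0 _) cosA cosB)
                      (ler_pM (normr_ge0 _) (normr_ge0 _) sinA sinB)) _.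
have -> : W * K + W * K = W * (2 * K) by ring.
rewrite [12 * W]mulrC -[leRHS]mulrA.
rewrite ler_wpM2l // /K mulrA (_ : 2 * 6 = 12); last by ring.
(* The lower bound [d] for this gcd serves the term with [L]; the upper bound [le_g] serves the term
   with [N]. *)
have dvd_g : (d %| gcdn m q)%N by rewrite dvdn_gcd dq andbT /m expnS dvdn_mull // dvdn_mulr.
have g0 : (0 < gcdn m q)%N by rewrite gcdn_gt0 q0 orbT.
have le_g : (gcdn m q <= gcdn h q * d ^ 2)%N.
  apply: dvdn_leq; first by rewrite muln_gt0 gcdn_gt0 q0 orbT expn_gt0 d0.
  rewrite muln_gcdl dvdn_gcd (@dvdn_mulr _ q) ?dvdn_gcdr // andbT.
  have co' : coprime (gcdn m q) c by rewrite coprime_sym (coprime_dvdr (dvdn_gcdr _ _)).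
  by rewrite -(Gauss_dvdr _ co') mulnA (mulnC c) dvdn_gcdl.
have s0 n : 0 <= Num.sqrt n%:R :> R by exact: sqrtr_ge0.
have L0 : 0 <= L R q by apply: le_trans (half_le_L R q0).
rewrite ler_wpM2l // lerD //.
  rewrite natrM -mulrA ler_wpM2l // mulrA ler_wpM2r ?invr_ge0 //.
  have -> : d%:R = Num.sqrt (d ^ 2)%:R :> R by rewrite natrX sqrtr_sqr ger0_norm.
  by rewrite -sqrtrM // ler_wsqrtr // -natrM ler_nat mulnC.
rewrite ler_wpM2r // ler_wpM2l // lef_pV2 ?posrE ?sqrtr_gt0 ?ltr0n //.
by rewrite ler_wsqrtr // ler_nat dvdn_leq.
Qed.

Lemma count_coprime_solutions (R : realType) (q c M N : nat)
    (ds : seq nat) (eps : nat -> R) :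
  (0 < q)%N -> {subset ds <= divisors q} ->
  (forall y, (0 < y)%N ->
    (coprime y q)%:R = \sum_(d <- ds) eps d * (d %| y)%N%:R) ->
  q%:R * (\sum_(j < N) \sum_(i < M)
     (coprime j.+1 q && (q %| i.+1 + c * j.+1 ^ 2)%N))%N%:R =
  \sum_(d <- ds) eps d * \sum_(h < q) \sum_(k < N %/ d) \sum_(i < M)
      cos (pi *+ 2 * h%:R * (i.+1 + c * (d * k.+1) ^ 2)%:R / q%:R).
Proof.
move=> q0 dsq coE.
pose T y : R := \sum_(i < M) (q %| i.+1 + c * y ^ 2)%N%:R.
have -> : (\sum_(j < N) \sum_(i < M)
     (coprime j.+1 q && (q %| i.+1 + c * j.+1 ^ 2)%N))%N%:R
   = \sum_(d <- ds) eps d * \sum_(k < N %/ d) T (d * k.+1)%N.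
  rewrite natr_sum (eq_bigr (fun j : 'I_N => \sum_(d <- ds)
      eps d * ((d %| j.+1)%N%:R * T j.+1))); last first.
    move=> j _; rewrite (eq_bigr (fun d => eps d * (d %| j.+1)%N%:R * T j.+1)); last first.
      by move=> d _; rewrite mulrA.
    rewrite -mulr_suml -coE // mulr_sumr natr_sum; apply: eq_bigr => i _.
    by case: (coprime _ _); rewrite ?mul1r ?mul0r.
  rewrite exchange_big; apply: eq_big_seq => d /dsq; rewrite -dvdn_divisors // => dq.
  by rewrite -mulr_sumr sum_multiples // (dvdn_gt0 q0 dq).
rewrite mulr_sumr; apply: eq_bigr => d _; rewrite mulrCA; congr (_ * _).
rewrite [RHS]exchange_big mulr_sumr; apply: eq_bigr => k _ /=.
rewrite [RHS]exchange_big mulr_sumr; apply: eq_bigr => i _ /=.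
by rewrite sum_cos_dvd // natrM.
Qed.

(** Sum the Moebius formula over [y = 1, ..., q]: each [d] in [ds] divides [q] and so has exactly
    [q / d] multiples there. *)
Lemma moebius_totient (R : realType) (q : nat) (ds : seq nat) (eps : nat -> R) :
  (0 < q)%N -> {subset ds <= divisors q} ->
  (forall y, (0 < y)%N ->
    (coprime y q)%:R = \sum_(d <- ds) eps d * (d %| y)%N%:R) ->
  \sum_(d <- ds) eps d / d%:R = (totient q)%:R / q%:R.
Proof.
move=> q0 dsq coE; have q0R : q%:R != 0 :> R by rewrite pnatr_eq0 -lt0n.
have -> : totient q = (\sum_(j < q) coprime j.+1 q)%N.
  rewrite totient_count_coprime -(big_mkord xpredT (fun j => nat_of_bool (coprime j.+1 q))).
  rewrite -(big_add1 _ _ 0 q.+1 xpredT (fun j => nat_of_bool (coprime j q))).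
  (* The totient counts over [0, ..., q - 1]; the window moves to [1, ..., q] because 0 and [q] have
     the same gcd with [q]. *)
  rewrite [LHS]big_ltn // [RHS]big_nat_recr //= addnC /coprime gcdn0 gcdnn.
  by congr (_ + _)%N; apply: eq_bigr => j _; rewrite gcdnC.
rewrite natr_sum (eq_bigr (fun j : 'I_q => \sum_(d <- ds) eps d * ((d %| j.+1)%N%:R * 1))); last first.
  by move=> j _; rewrite coE //; apply: eq_bigr => d _; rewrite mulr1.
rewrite exchange_big mulr_suml; apply: eq_big_seq => d /dsq; rewrite -dvdn_divisors // => dq.
have d0 := dvdn_gt0 q0 dq.
rewrite -mulr_sumr (sum_multiples q (fun=> 1) d0) sumr_const card_ord.
have -> : q%:R = (q %/ d)%:R * d%:R :> R by rewrite -natrM divnK.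
field; rewrite pnatr_eq0 -lt0n d0 pnatr_eq0 -lt0n divn_gt0 // dvdn_leq //.
Qed.

(** * From pairs of integers to a normalized congruence in natural numbers *)

Lemma M12E (R : realType) (X Y : R) (a b : int) (q : nat) : 0 <= X -> 0 <= Y ->
  M12 X Y a b q = (\sum_(j < Num.truncn Y) \sum_(i < Num.truncn X)
    (coprimez (i.+1%:Z * j.+1%:Z) q &&
     (a * i.+1%:Z + b * j.+1%:Z ^+ 2 == 0 %[mod q])%Z))%N.
Proof.
move=> X0 Y0; pose f (p : nat * nat) : int * int := (p.2.+1%:Z, p.1.+1%:Z).
pose P (p : int * int) := coprimez (p.1 * p.2) q &&
  (a * p.1 + b * p.2 ^+ 2 == 0 %[mod q])%Z.
pose s := [seq f p | p <- [seq (j, i) | j <- iota 0 (Num.truncn Y), i <- iota 0 (Num.truncn X)]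
                     & P (f p)].
have us : uniq s.
  rewrite map_inj_uniq; last by move=> [j i] [j' i'] [] -> ->.
  by rewrite filter_uniq // allpairs_uniq ?iota_uniq // => -[? ?] [? ?] _ _ [-> ->].
have bound (Z : R) (z : int) : 0 <= Z ->
    reflect (exists2 k, (k < Num.truncn Z)%N & z = k.+1%:Z) (0 < (z%:~R : R) <= Z).
  move=> Z0; apply: (iffP andP) => [[]|[k kZ ->]].
    rewrite ltr0z; case: z => [[|k]|] // _ kZ; exists k => //.
    by rewrite truncn_ge_nat.
  by rewrite ltr0z; split => //; rewrite truncn_ge_nat in kZ.
have memS p : (p \in fset_set (solutions12 X Y a b q)) = (p \in s).
  rewrite in_fset_set; last exact: finite_solutions12.
  apply/idP/idP; case: p => x y.
    rewrite inE /solutions12 /= => -[/(bound _ _ X0)[i iX ->] /(bound _ _ Y0)[j jY ->] co E].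
    apply/mapP; exists (j, i) => //; rewrite mem_filter /P /= co; apply/andP; split.
      exact/eqP.
    by apply/allpairsP; exists (j, i); rewrite !mem_iota.
  move=> /mapP[[j i]]; rewrite mem_filter => /andP[/andP[co /eqP E]].
  case/allpairsP => -[j' i'] /= []; rewrite !mem_iota /= !add0n => jY iX [? ?] [-> ->].
  subst j i.
  rewrite inE /solutions12 /=; split => //.
  - by apply/(bound _ _ X0); exists i'.
  - by apply/(bound _ _ Y0); exists j'.
have -> : M12 X Y a b q = size s.
  by apply/perm_size/uniq_perm; rewrite ?fset_uniq.
rewrite size_map size_filter -sum1_count big_mkcond big_allpairs /=.
rewrite -{1}[Num.truncn Y]subn0 -/(index_iota _ _) big_mkord; apply: eq_bigr => j _.
rewrite -{1}[Num.truncn X]subn0 -/(index_iota _ _) big_mkord; apply: eq_bigr => i _.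
by rewrite /P /=; case: (_ && _).
Qed.

(** Here [c] is the residue of [u * b], with [u] an inverse of [a] modulo [q] taken from a Bezout
    relation. *)
Lemma congruence_normalize (a b : int) (q : nat) : (0 < q)%N -> coprimez (a * b) q ->
  exists2 c, coprime c q & forall x y : nat,
    coprimez (x%:Z * y%:Z) q && (a * x%:Z + b * y%:Z ^+ 2 == 0 %[mod q])%Z =
    coprime y q && (q %| x + c * y ^ 2)%N.
Proof.
move=> q0; rewrite coprimezMl => /andP[coa cob].
have [[u v] /= uv] := coprimezP _ _ coa.
pose c := `|(u * b %% q)%Z|%N.
have cE : (c%:Z = u * b %[mod q])%Z.
  by rewrite /c gez0_abs ?modz_ge0 ?modz_mod // eqz_nat -lt0n.
have cou : coprimez u q.
  by apply/coprimezP; exists (a, v); rewrite /= mulrC.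
have coc : coprime c q.
  suff : coprimez c q by [].
  by rewrite /coprimez -gcdz_modl cE gcdz_modl -/(coprimez _ _) coprimezMl cou.
exists c => // x y.
have -> : (a * x%:Z + b * y%:Z ^+ 2 == 0 %[mod q])%Z = (q %| x + c * y ^ 2)%N.
  rewrite eqz_mod_dvd subr0 -(@Gauss_dvdzr q u) 1?coprimez_sym //.
  have E : (u * (a * x%:Z + b * y%:Z ^+ 2) = (x + c * y ^ 2)%N%:Z %[mod q])%Z.
    have -> : u * (a * x%:Z + b * y%:Z ^+ 2) =
        - (v * x%:Z) * q%:Z + (x%:Z + u * b * y%:Z ^+ 2).
      by rewrite -[in RHS](mul1r x%:Z) -{2}uv; ring.
    by rewrite modzMDl -modzDmr -modzMml -cE modzMml modzDmr PoszD PoszM.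
  have dvdE z : (q %| z)%Z = (z == 0 %[mod q])%Z by rewrite eqz_mod_dvd subr0.
  by rewrite dvdE E -dvdE.
rewrite coprimezMl -andbA -[coprimez x q]/(coprime x q) -[coprimez y q]/(coprime y q).
have [D|] := boolP (q %| _)%N; last by rewrite !andbF.
rewrite !andbT; have [coy|] := boolP (coprime y q); last by rewrite andbF.
have con : coprime (c * y ^ 2) q by rewrite coprimeMl coc coprimeXl.
(* A common divisor of [x] and [q] divides [c * y ^ 2], which is coprime to [q]. *)
rewrite andbT /coprime -dvdn1 -(eqP con) dvdn_gcd dvdn_gcdr andbT.
by rewrite -(dvdn_addr _ (dvdn_gcdl x q)) (dvdn_trans (dvdn_gcdr x q)).
Qed.

(** * Summation over frequencies and divisors, and the final estimate *)

(** The reflection [h -> q - h] preserves the gcd with [q], so both halves of the weight contribute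
    equally. This factor 2 and the 2 of the harmonic bounds give the constant 4. *)
Lemma sum_weight_gcd (R : realType) (q : nat) (A B : R) :
  (0 < q)%N -> 0 <= A -> 0 <= B ->
  \sum_(1 <= h < q) (q%:R / h%:R + q%:R / (q - h)%:R)
    * (A * Num.sqrt (gcdn h q)%:R + B) <=
  4 * q%:R * L R q * (A * sigma (- 2^-1) q + B).
Proof.
move=> q0 A0 B0; pose F h : R := q%:R / h%:R * (A * Num.sqrt (gcdn h q)%:R + B).
have -> : \sum_(1 <= h < q) (q%:R / h%:R + q%:R / (q - h)%:R)
    * (A * Num.sqrt (gcdn h q)%:R + B) = 2 * \sum_(1 <= h < q) F h.
  under eq_bigr do rewrite mulrDl.
  rewrite big_split /= (natrD _ 1 1) mulrDl mul1r; congr (_ + _).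
  rewrite [RHS]big_nat_rev /=; apply: eq_big_nat => h /andP[h1 hq].
  rewrite /F add1n subSS; congr (_ * (A * Num.sqrt _%:R + B)).
  transitivity (gcdn h (q - h)); first by rewrite -(gcdnDr h (q - h)) subnK // ltnW.
  by rewrite gcdnC -(gcdnDl (q - h) h) subnK // ltnW.
have -> : \sum_(1 <= h < q) F h = q%:R * (A * (\sum_(1 <= h < q) Num.sqrt (gcdn h q)%:R / h%:R)
    + B * \sum_(1 <= h < q) h%:R^-1).
  rewrite !mulr_sumr -big_split mulr_sumr; apply: eq_bigr => h _ /=.
  by rewrite /F; ring.
have q0R : 0 <= q%:R :> R by [].
have H1 := ler_wpM2l A0 (sum_sqrt_gcd R q0).
have H2 := ler_wpM2l B0 (harmonic_le_L R q).
have H3 := ler_wpM2l q0R (lerD H1 H2).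
lra.
Qed.

(** Each rounded quotient differs from [Y / d] by at most 1, and there are at most [tau q] of
    them. *)
Lemma moebius_floor (R : realType) (q : nat) (Y : R) (ds : seq nat) (eps : nat -> R) :
  (0 < q)%N -> 0 <= Y -> uniq ds -> {subset ds <= divisors q} -> (forall d, `|eps d| <= 1) ->
  (forall y, (0 < y)%N ->
    (coprime y q)%:R = \sum_(d <- ds) eps d * (d %| y)%N%:R) ->
  `|\sum_(d <- ds) eps d * (Num.truncn Y %/ d)%:R - (totient q)%:R / q%:R * Y| <=
  (tau q)%:R.
Proof.
move=> q0 Y0 uds dsq epsb coE; rewrite -(moebius_totient q0 dsq coE) mulr_suml -sumrB.
apply: le_trans (ler_norm_sum _ _ _) _.
apply: le_trans (_ : \sum_(d <- ds) 1 <= _); last first.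
  rewrite /tau -sum1_size natr_sum; exact: le_sum_subseq.
rewrite big_seq [leRHS]big_seq ler_sum // => d /dsq; rewrite -dvdn_divisors // => dq.
have d0 := dvdn_gt0 q0 dq; have d0R : 0 < d%:R :> R by rewrite ltr0n.
rewrite -mulrA -mulrBr normrM -[leRHS]mulr1 ler_pM // mulrC.
have /andP[NY YN] := truncn_itv Y0; set N := Num.truncn Y in NY YN *.
have lo : (N %/ d)%:R <= Y / d%:R.
  by rewrite ler_pdivlMr // (le_trans _ NY) // -natrM ler_nat leq_trunc_div.
have hi : Y / d%:R <= (N %/ d)%:R + 1.
  rewrite ler_pdivrMr // (le_trans (ltW YN)) // natr1 -natrM ler_nat.
  by rewrite ltn_ceil.
by rewrite ler_norml; apply/andP; split; lra.
Qed.

Theorem theorem1p1 (R : realType) :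
  exists2 C : R, 0 < C &
    forall (a b : int) (q : nat) (X Y : R),
      a != 0 -> b != 0 -> (1 <= q)%N -> coprimez (a * b) q ->
      1 <= X -> 1 <= Y ->
      `|(M12 X Y a b q)%:R - (totient q)%:R / q%:R ^+ 2 * (X * Y)| <=
        C * (X / q%:R * (tau q)%:R
             + L R q * sigma (- 2^-1 : R) q
               * (Y / Num.sqrt q%:R * (tau q)%:R + Num.sqrt q%:R * L R q)).
Proof.
(* The constant is 48 + 2: 48 = 12 * 4 from the nonzero frequencies, and 2 from absorbing the
   rounding of [X]. *)
exists 50 => // a b q X Y _ _ q0 coab X1 Y1.
have X0 : 0 <= X by lra.
have Y0 : 0 <= Y by lra.
have [c coc congr_c] := congruence_normalize q0 coab.
have [ds [eps [uds dsq epsb coE]]] := coprime_moebius R q0.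
rewrite M12E //; set M := Num.truncn X; set N := Num.truncn Y.
have /andP[MX XM] := truncn_itv X0; have /andP[NY YN] := truncn_itv Y0.
rewrite -/M in MX XM; rewrite -/N in NY YN.
under eq_bigr do under eq_bigr do rewrite congr_c.
set count := (\sum_(j < N) _)%N.
pose V h d : R := \sum_(k < N %/ d) \sum_(i < M)
  cos (pi *+ 2 * h%:R * (i.+1 + c * (d * k.+1) ^ 2)%:R / q%:R).
pose E := \sum_(d <- ds) eps d * \sum_(1 <= h < q) V h d.
pose N0 := \sum_(d <- ds) eps d * (N %/ d)%:R.
(* At frequency 0 all cosines are 1, which leaves [M] times the Moebius sum [N0]. *)
have countE : q%:R * count%:R = M%:R * N0 + E.
  rewrite (count_coprime_solutions c M N q0 dsq coE) mulr_sumr -big_split.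
  apply: eq_bigr => d _ /=.
  rewrite -(big_mkord xpredT (fun h => V h d)) big_ltn // mulrDr; congr (_ + _).
  rewrite mulrCA; congr (_ * _); rewrite /V.
  rewrite (eq_bigr (fun=> M%:R)) ?sumr_const ?card_ord ?mulr_natr // => k _.
  rewrite (eq_bigr (fun=> 1)) ?sumr_const ?card_ord // => i _.
  by rewrite mulr0n !mul0r cos0.
have q0R : 0 < q%:R :> R by rewrite ltr0n.
have s0 : 0 < Num.sqrt q%:R :> R by rewrite sqrtr_gt0.
have L2 := half_le_L R q0.
have t1 : 1 <= (tau q)%:R :> R.
  by rewrite ler1n /tau -has_predT; apply/hasP; exists 1%N; rewrite ?divisor1.
have sg1 : 1 <= sigma (- 2^-1 : R) q.
  rewrite sigmaE // (big_rem _ (divisor1 q)) /= sqrtr1 invr1 lerDl.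
  by apply: sumr_ge0 => d _; rewrite invr_ge0 sqrtr_ge0.
set t := (tau q)%:R in t1 *; set sg := sigma _ q in sg1 *.
set la := L R q in L2 *; set s := Num.sqrt q%:R in s0 *.
have leE : `|E| <= 48 * q%:R * la * sg * (Y / s * t + s * la).
  pose w h : R := q%:R / h%:R + q%:R / (q - h)%:R.
  pose G h d : R := 12 * w h * (Y * (Num.sqrt (gcdn h q)%:R / s) + s / Num.sqrt d%:R * la).
  have leV d h : d \in ds -> (0 < h < q)%N -> `|V h d| <= G h d.
    move=> /dsq; rewrite -dvdn_divisors // => dq hq.
    apply: le_trans (quadratic_double_sum_le R M (N %/ d) hq dq coc) _.
    rewrite ler_wpM2l ?mulr_ge0 ?addr_ge0 ?divr_ge0 // lerD2r.
    apply: ler_wpM2r; first exact: divr_ge0 (sqrtr_ge0 _) (ltW s0).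
    by apply: le_trans NY; rewrite ler_nat leq_trunc_div.
  have G0 d h : 0 <= G h d.
    have la0 : 0 <= la by lra.
    have w0 : 0 <= w h by rewrite addr_ge0 ?divr_ge0.
    have ge0 n : 0 <= Num.sqrt n%:R :> R by exact: sqrtr_ge0.
    apply: mulr_ge0; first exact: mulr_ge0.
    by apply: addr_ge0; apply: mulr_ge0 => //; apply: divr_ge0 => //; exact: ltW.
  (* The majorants are nonnegative, so the sum may be extended from [ds] to all divisors of [q];
     this produces [tau] and [sigma]. *)
  apply: le_trans (_ : \sum_(d <- divisors q) \sum_(1 <= h < q) G h d <= _).
    apply: le_trans (le_sum_subseq uds dsq (fun d => sumr_ge0 _ (fun h _ => G0 d h))).
    apply: le_trans (ler_norm_sum _ _ _) _.
    rewrite big_seq [leRHS]big_seq ler_sum // => d dds.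
    rewrite normrM -[leRHS]mul1r ler_pM //.
    apply: le_trans (ler_norm_sum _ _ _) _.
    by apply: ler_sum_nat => h /(leV d h dds).
  rewrite exchange_big /=.
  have GE h : \sum_(d <- divisors q) G h d =
      12 * (w h * (Y / s * t * Num.sqrt (gcdn h q)%:R + s * sg * la)).
    rewrite -mulr_sumr big_split /= big_const_seq count_predT iter_addr_0 -mulr_suml.
    rewrite -mulr_sumr -sigmaE // -/sg -/t -[_ *+ _]mulr_natr /t /tau; ring.
  rewrite (eq_bigr _ (fun h _ => GE h)) -mulr_sumr.
  have A0 : 0 <= Y / s * t by rewrite !mulr_ge0 ?invr_ge0 ?(ltW s0).
  have B0 : 0 <= s * sg * la by rewrite !mulr_ge0 ?(ltW s0) //; lra.
  have := sum_weight_gcd q0 A0 B0; rewrite -/la -/sg => H.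
  apply: le_trans (ler_wpM2l _ H) _ => //.
  by rewrite le_eqVlt; apply/orP; left; apply/eqP; ring.
have leN0 := moebius_floor q0 Y0 uds dsq epsb coE.
rewrite -/N -/N0 -/t in leN0.
set phi := (totient q)%:R / q%:R in leN0.
have phi01 : 0 <= phi <= 1.
  apply/andP; split; first exact: divr_ge0.
  rewrite ler_pdivrMr // mul1r ler_nat totient_count_coprime.
  rewrite (leq_trans (leq_sum _ (fun d _ => leq_b1 _))) //.
  by rewrite sum_nat_const_nat muln1 subn0.
rewrite -(ler_pM2l q0R) -[X in X * `|_|](gtr0_norm q0R) -normrM mulrBr countE.
have -> : q%:R * ((totient q)%:R / q%:R ^+ 2 * (X * Y)) = phi * (X * Y).
  by rewrite /phi; field; rewrite gt_eqF.
(* Three errors: rounding in the Moebius sum, rounding [X] to [M], and the nonzero frequencies. *)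
have -> : M%:R * N0 + E - phi * (X * Y) = M%:R * (N0 - phi * Y) + (M%:R - X) * (phi * Y) + E.
  by ring.
have part1 : `|M%:R * (N0 - phi * Y)| <= X * t.
  by rewrite normrM ger0_norm // ler_pM.
have part2 : `|(M%:R - X) * (phi * Y)| <= Y.
  case/andP: phi01 => phi0 phi1.
  rewrite normrM -[leRHS]mul1r ler_pM //.
    by rewrite ler_norml; rewrite -natr1 in XM; apply/andP; split; lra.
  by rewrite ger0_norm ?mulr_ge0 // -[leRHS]mul1r ler_wpM2r.
(* The rounding error [Y] fits into the first error term because [q / s = s], and [s], [t], [sg] and
   [2 * la] are all at least 1. *)
have Ysq : Y <= 2 * q%:R * la * sg * (Y / s * t + s * la).
  have qE : q%:R = s * s by rewrite -expr2 sqr_sqrtr.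
  have sge1 : 1 <= s by rewrite -[leLHS]sqrtr1 ler_wsqrtr // ler1n.
  have -> : 2 * q%:R * la * sg * (Y / s * t + s * la) =
      2 * la * sg * t * s * Y + 2 * q%:R * la * sg * s * la.
    by rewrite qE; field; rewrite gt_eqF.
  apply: le_trans (_ : 2 * la * sg * t * s * Y <= _); last first.
    have ? : 0 <= la by lra.
    have ? : 0 <= sg by lra.
    by rewrite lerDl !mulr_ge0 // ltW.
  have la2 : 1 <= 2 * la by lra.
  by apply: ler_peMl => //; do 3 ! apply: mulr_ege1 => //.
apply: le_trans (ler_normD _ _) _; apply: le_trans (lerD (ler_normD _ _) leE) _.
apply: le_trans (lerD (lerD part1 part2) (lexx _)) _.
apply: le_trans (lerD (lerD (lexx _) Ysq) (lexx _)) _.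
have -> : q%:R * (50 * (X / q%:R * t + la * sg * (Y / s * t + s * la))) =
    50 * (X * t) + 50 * q%:R * la * sg * (Y / s * t + s * la).
  by field; rewrite !gt_eqF.
have Xt : 0 <= X * t by rewrite mulr_ge0 //; lra.
lra.
Qed.
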